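(* Let $R$ be a $\mathbb{Q}$-domain with field of fractions $K$, $n=2$, and let $D\in\mathrm{LND}_R R[x_1,x_2]$ be such that $\exp D\in\mathrm{T}(R,\mathbf{x})$. Then there exists $\tau\in\mathrm{T}(R,\mathbf{x})$ such that $\tau^{-1}\circ D\circ\tau$ is triangular or affine. If $V(R)=K^\times$, then there exists $\tau\in\mathrm{T}(R,\mathbf{x})$ such that $\tau^{-1}\circ D\circ\tau$ is triangular.
   Context: $\mathrm{LND}_R R[\mathbf{x}]$ is the set of $R$-derivations $D$ with $D^l(f)=0$ for some $l$ depending on $f$; $\exp D(f)=\sum_{l\ge0}D^l(f)/l!$. $\mathrm{T}(R,\mathbf{x})$ is the subgroup of $\mathrm{Aut}(R[\mathbf{x}]/R)$ generated by affine automorphisms ($\deg\phi(x_i)=1$ for all $i$) and elementary automorphisms (fixing all variables but one). A derivation $D$ is triangular if $D(x_i)\in R[x_1,\dots,x_{i-1}]$ for all $i$, and affine if $\deg D(x_i)\le1$ for all $i$. $V(R)$ is the set of $\alpha/\beta\in K^\times$ with $\alpha,\beta\in R\setminus\{0\}$, $\alpha R+\beta R=R$. *)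

(* Defs.v *)
From HB Require Import structures.
From mathcomp Require Import all_boot all_order all_algebra.
From mathcomp Require Import fraction.
From mathcomp.multinomials Require Import mpoly.
From Stdlib Require Import ClassicalEpsilon.
Set Implicit Arguments. Unset Strict Implicit. Unset Printing Implicit Defensive.
Import Order.TTheory GRing.Theory Num.Theory.
Local Open Scope ring_scope.

(* R[x_1,...,x_n] is {mpoly R[n]}; the variable x_{i+1} is 'X_i (i : 'I_n). *)

Section Defs.
Variables (R : idomainType) (n : nat).
Local Notation P := {mpoly R[n]}.

Definition Q_domain : Prop := forall k : nat, (k.+1)%:R \is a (@GRing.unit R).

Definition is_Ralg_endo (f : P -> P) : Prop :=
  [/\ forall p q, f (p + q) = f p + f q,
      forall p q, f (p * q) = f p * f q,
      f 1 = 1 &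
      forall c : R, f c%:MP = c%:MP].

Definition is_Raut (f : P -> P) : Prop := is_Ralg_endo f /\ bijective f.

Definition affine_aut (f : P -> P) : Prop :=
  is_Raut f /\ forall i : 'I_n, msize (f 'X_i) = 2%N.

Definition elementary_aut (f : P -> P) : Prop :=
  is_Raut f /\ exists i : 'I_n, forall j : 'I_n, j != i -> f 'X_j = 'X_j.

Inductive tame : (P -> P) -> Prop :=
| tame_id : tame id
| tame_affine f : affine_aut f -> tame f
| tame_elem f : elementary_aut f -> tame f
| tame_comp f g : tame f -> tame g -> tame (f \o g)
| tame_inv f g : tame f -> cancel f g -> cancel g f -> tame g
| tame_ext f g : tame f -> f =1 g -> tame g.

Definition is_Rder (D : P -> P) : Prop :=
  [/\ forall p q, D (p + q) = D p + D q,
      forall (c : R) p, D (c *: p) = c *: D p &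
      forall p q, D (p * q) = p * D q + q * D p].

Definition is_LND (D : P -> P) : Prop :=
  is_Rder D /\ forall f, exists l : nat, iter l D f = 0.

(* some l with D^l(f) = 0 (any such l gives the same value of exp D f) *)
Definition nil_index (D : P -> P) (f : P) : nat :=
  epsilon (inhabits 0%N) (fun l => iter l D f = 0).

Definition expD (D : P -> P) (f : P) : P :=
  \sum_(l < nil_index D f) ((l`!)%:R)^-1 *: iter l D f.

Definition in_first_vars (k : nat) (p : P) : Prop :=
  forall m, m \in msupp p -> forall j : 'I_n, (k <= j)%N -> m j = 0%N.

Definition triangular_der (D : P -> P) : Prop :=
  forall i : 'I_n, in_first_vars i (D 'X_i).

Definition affine_der (D : P -> P) : Prop :=
  forall i : 'I_n, (msize (D 'X_i) <= 2)%N.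

End Defs.

Definition V_is_Kunits (R : idomainType) : Prop :=
  forall k : {fraction R}, k != 0 ->
    exists alpha beta : R, [/\ alpha != 0, beta != 0,
      (exists u v : R, u * alpha + v * beta = 1) &
      k = (tofrac alpha) / (tofrac beta)].

(* Main.v *)
Require Import Defs.
From HB Require Import structures.
From mathcomp Require Import all_boot all_order all_algebra.
From mathcomp Require Import fraction.
From mathcomp.multinomials Require Import mpoly.
From mathcomp Require Import zify ring.
From Stdlib Require Import ClassicalEpsilon FunctionalExtensionality.
Set Implicit Arguments. Unset Strict Implicit. Unset Printing Implicit Defensive.
Import GRing.Theory.
Local Open Scope ring_scope.

(* Work with words in affine automorphisms and automorphisms f with
   f x0 = a x0 + b.  Take a word representing a tame conjugate of exp D.  If two
   cyclically adjacent syllables lie in the same subgroup, the word shortens,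
   possibly after a conjugation.  Otherwise, if the length is at least 2, the
   degree of the powers is unbounded, as in the amalgam structure of the tame
   group; but the degrees of (exp D)^m q are bounded by those of the finitely
   many nonzero D^l q.  Hence some conjugate of exp D is affine or triangular.
   A submodule stable under exp D is stable under D, so the corresponding
   conjugate of D is affine or triangular.  An affine D kills, modulo constants,
   a nonzero linear form a x0 + b x1; if V(R) = K^*, this form is proportional
   to a unimodular one, which can be taken as the new x0. *)

(** * Generators of the polynomial ring and algebra endomorphisms *)

Lemma mpoly_gen_ind (R : idomainType) n (P : {mpoly R[n]} -> Prop) :
  (forall c, P c%:MP) -> (forall i, P 'X_i) ->
  (forall p q, P p -> P q -> P (p + q)) ->
  (forall p q, P p -> P q -> P (p * q)) -> forall p, P p.
Proof.
move=> PC PX PD PM p; rewrite (mpolyE p).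
apply: (big_ind P) => [||m _]; [by rewrite -mpolyC0; apply: PC | exact: PD |].
rewrite -mul_mpolyC; apply: (PM) => //; rewrite mpolyXE_id.
have P1 : P 1 by rewrite -mpolyC1; apply: PC.
apply: (big_ind P) => [||i _] //; elim: (m i) => [|k IHk]; first by rewrite expr0.
by rewrite exprS; apply: PM.
Qed.

Section Endo.
Variables (R : idomainType) (n : nat).
Implicit Types f g : {mpoly R[n]} -> {mpoly R[n]}.

Section Theory.
Variable f : {mpoly R[n]} -> {mpoly R[n]}.
Hypothesis Hf : is_Ralg_endo f.

Lemma endoD p q : f (p + q) = f p + f q. Proof. by case: Hf. Qed.
Lemma endoM p q : f (p * q) = f p * f q. Proof. by case: Hf. Qed.
Lemma endoC c : f c%:MP = c%:MP. Proof. by case: Hf. Qed.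
Lemma endo1 : f 1 = 1. Proof. by case: Hf. Qed.
Lemma endoZ c p : f (c *: p) = c *: f p.
Proof. by rewrite -!mul_mpolyC endoM endoC. Qed.
Lemma endo0 : f 0 = 0. Proof. by rewrite -mpolyC0 endoC. Qed.
Lemma endoN p : f (- p) = - f p. Proof. by rewrite -scaleN1r endoZ scaleN1r. Qed.
Lemma endoB p q : f (p - q) = f p - f q. Proof. by rewrite endoD endoN. Qed.

End Theory.

Lemma endo_comp f g : is_Ralg_endo f -> is_Ralg_endo g -> is_Ralg_endo (f \o g).
Proof.
move=> Hf Hg; split=> [p q|p q||c] /=.
- by rewrite !endoD.
- by rewrite !endoM.
- by rewrite !endo1.
- by rewrite !endoC.
Qed.

Lemma endo_can f g : is_Ralg_endo f -> cancel f g -> cancel g f -> is_Ralg_endo g.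
Proof.
move=> Hf fK gK; have fI := can_inj fK.
split=> [p q|p q||c]; apply: fI; rewrite gK.
- by rewrite endoD // !gK.
- by rewrite endoM // !gK.
- by rewrite endo1.
- by rewrite endoC.
Qed.

Lemma raut_id : is_Raut (@id {mpoly R[n]}). Proof. by split; [|exists id]. Qed.

Lemma raut_comp f g : is_Raut f -> is_Raut g -> is_Raut (f \o g).
Proof. by move=> [? ?] [? ?]; split; [exact: endo_comp|exact: bij_comp]. Qed.

Lemma raut_can f g : is_Raut f -> cancel f g -> cancel g f -> is_Raut g.
Proof. by move=> [? _] fK gK; split; [exact: endo_can fK gK|exists f]. Qed.

Lemma raut_const f p c : is_Raut f -> f p = c%:MP -> p = c%:MP.
Proof. by move=> [Hf /bij_inj fI] E; apply: fI; rewrite E endoC. Qed.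

Lemma tame_raut f : tame f -> is_Raut f.
Proof.
elim=> {f} [|f []|f []|f g _ Hf _ Hg|f g _ Hf fK gK|f g _ Hf /functional_extensionality <-] //.
- exact: raut_id.
- exact: raut_comp.
- exact: raut_can fK gK.
Qed.

Lemma endo_ext f g : is_Ralg_endo f -> is_Ralg_endo g ->
  (forall i : 'I_n, f 'X_i = g 'X_i) -> f = g.
Proof.
move=> Hf Hg fg; apply: functional_extensionality; apply: mpoly_gen_ind => //.
- by move=> c; rewrite !endoC.
- by move=> p q; rewrite !endoD // => -> ->.
- by move=> p q; rewrite !endoM // => -> ->.
Qed.
End Endo.

(** * Two variables: substitutions and evaluation of univariate polynomials *)

Section Plane.
Variable R : idomainType.
Local Notation P := {mpoly R[2]}.
Local Notation x0 := ('X_(ord0 : 'I_2) : P).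
Local Notation x1 := ('X_(ord_max : 'I_2) : P).
Implicit Types (f g s t D : P -> P) (p q F G : P).

Lemma ord2P (Q : 'I_2 -> Prop) : Q ord0 -> Q ord_max -> forall i, Q i.
Proof.
by move=> Q0 Q1 [[|[|[]]] lti] //; [move: Q0|move: Q1]; congr Q; apply: val_inj.
Qed.

Lemma endo2_ext f g : is_Ralg_endo f -> is_Ralg_endo g ->
  f x0 = g x0 -> f x1 = g x1 -> f = g.
Proof. by move=> Hf Hg e0 e1; apply: endo_ext => //; apply: ord2P. Qed.

Definition subst2 F0 F1 : P -> P := comp_mpoly [tuple F0; F1].

Lemma subst2_endo F0 F1 : is_Ralg_endo (subst2 F0 F1).
Proof.
split=> [p q|p q||c]; first exact: comp_mpolyD.
- by rewrite /subst2 rmorphM.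
- exact: comp_mpoly1.
- exact: comp_mpolyC.
Qed.

Lemma subst2_x0 F0 F1 : subst2 F0 F1 x0 = F0.
Proof. by rewrite /subst2 comp_mpolyXU. Qed.

Lemma subst2_x1 F0 F1 : subst2 F0 F1 x1 = F1.
Proof. by rewrite /subst2 comp_mpolyXU. Qed.

Definition peval (h : {poly R}) F : P := (map_poly (@mpolyC 2 R) h).[F].

Lemma pevalD h k F : peval (h + k) F = peval h F + peval k F.
Proof. by rewrite /peval rmorphD hornerD. Qed.
Lemma pevalM h k F : peval (h * k) F = peval h F * peval k F.
Proof. by rewrite /peval rmorphM hornerM. Qed.
Lemma pevalC c F : peval c%:P F = c%:MP.
Proof. by rewrite /peval map_polyC hornerC. Qed.
Lemma peval0 F : peval 0 F = 0.
Proof. by rewrite -polyC0 pevalC mpolyC0. Qed.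
Lemma pevalX F : peval 'X F = F.
Proof. by rewrite /peval map_polyX hornerX. Qed.
Lemma pevalZ c h F : peval (c *: h) F = c *: peval h F.
Proof. by rewrite -mul_polyC pevalM pevalC mul_mpolyC. Qed.

Lemma endo_peval f h F : is_Ralg_endo f -> f (peval h F) = peval h (f F).
Proof.
move=> Hf; elim/poly_ind: h => [|h c IHh]; first by rewrite -polyC0 !pevalC endoC.
by rewrite !(pevalD, pevalM, pevalX, pevalC) endoD // endoM // IHh endoC.
Qed.

Lemma peval_comp h k F : peval (h \Po k) F = peval h (peval k F).
Proof.
elim/poly_ind: h => [|h c IHh]; first by rewrite comp_poly0 -polyC0 !pevalC.
by rewrite comp_polyD comp_polyM comp_polyX comp_polyC !(pevalD, pevalM, pevalX, pevalC) IHh.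
Qed.

Lemma endo2_can f g : is_Ralg_endo f -> is_Ralg_endo g ->
  g (f x0) = x0 -> g (f x1) = x1 -> cancel f g.
Proof.
move=> Hf Hg gf0 gf1 p.
suff E : g \o f = id by rewrite -[LHS]/((g \o f) p) E.
by apply: endo2_ext => //; apply: endo_comp.
Qed.

(** * Affine polynomials and degree estimates ([msize] is the degree plus one, and 0 at 0) *)

Lemma mdeg_le1 (m : 'X_{1..2}) : (mdeg m <= 1)%N ->
  [\/ m = 0%MM, m = U_(ord0)%MM | m = U_(ord_max)%MM].
Proof.
case/boolP: (mdeg m == 1%N) => [/mdeg1P[i /eqP ->] _|ne1 le1].
  by elim/ord2P: i; [constructor 2 | constructor 3].
by constructor 1; apply/eqP; rewrite -mdeg_eq0; lia.
Qed.

Lemma affE p : (msize p <= 2)%N -> exists a b c, p = a *: x0 + b *: x1 + c%:MP.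
Proof.
move=> Hp; exists p@_U_(ord0), p@_U_(ord_max), p@_0%MM.
apply/mpolyP => m; rewrite !mcoeffD !mcoeffZ !mcoeffX mcoeffC.
have [/mdeg_le1[]->|gt1] := leqP (mdeg m) 1.
- by rewrite !mnm1_eq0 eqxx !mulr0 mulr1 !add0r.
- by rewrite !eq_mnm1 mnm1_eq0 eqxx !mulr0 mulr1 !addr0.
- by rewrite !eq_mnm1 mnm1_eq0 eqxx !mulr0 mulr1 add0r addr0.
rewrite memN_msupp_eq0 ?msize_mdeg_ge //; last by lia.
rewrite !(eq_sym _ m) -mdeg_eq0.
have U i : (m == U_(i)%MM) = false.
  by apply/negbTE; apply: contraTneq gt1 => ->; rewrite mdeg1.
by rewrite !U gtn_eqF ?mulr0 ?addr0 //; lia.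
Qed.

Lemma msize_const c : (msize (c%:MP : P) <= 1)%N.
Proof. by rewrite mmeasureC; case: (c == 0). Qed.

Lemma msizeD_max p q k : (msize p <= k)%N -> (msize q <= k)%N -> (msize (p + q) <= k)%N.
Proof. by have := msizeD_le p q; lia. Qed.

Lemma msizeZ_max c p k : (msize p <= k)%N -> (msize (c *: p) <= k)%N.
Proof. by have := msizeZ_le p c; lia. Qed.

Lemma msize_affine_le a b c p q k : (msize p <= k)%N -> (msize q <= k)%N -> (0 < k)%N ->
  (msize (a *: p + b *: q + c%:MP) <= k)%N.
Proof.
move=> Hp Hq k0; apply: msizeD_max; last exact: leq_trans (msize_const c) k0.
by apply: msizeD_max; apply: msizeZ_max.
Qed.

(** No cancellation can occur: the reverse bound comes from [q = (p + q) - p]. *)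
Lemma msizeDr p q : (msize p < msize q)%N -> msize (p + q) = msize q.
Proof.
move=> lt_pq; apply/eqP; rewrite eqn_leq.
have := msizeD_le p q; have := msizeD_le (p + q) (- p).
by rewrite addrC addKr mmeasureN; lia.
Qed.
Lemma msize_aff a b c p q : (msize p < msize q)%N -> (1 < msize q)%N -> b != 0 ->
  msize (a *: p + b *: q + c%:MP) = msize q.
Proof.
move=> lt_pq gt1 b0; have Hc := msize_const c.
have Ha := msizeZ_le p a.
have Hb := msizeZ q b0.
have E := @msizeDr (a *: p) (b *: q); rewrite Hb in E.
by rewrite addrC msizeDr E; lia.
Qed.

(** Horner induction: over a domain degrees add in [peval h F * F], and since [F] is not constant
    the added constant cannot affect the degree when [h] is nonzero. *)
Lemma size_peval h F : h != 0 -> (1 < msize F)%N ->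
  msize (peval h F) = ((size h).-1 * (msize F).-1).+1.
Proof.
move=> + F1; elim/poly_ind: h => [|h c IHh]; first by rewrite eqxx.
have Hc := msize_const c.
rewrite pevalD pevalM pevalX pevalC size_MXaddC.
have [->|h0] := eqVneq h 0.
  rewrite !mul0r !add0r polyC_eq0 => c0.
  by rewrite peval0 mul0r add0r (negPf c0) size_poly0 mmeasureC c0.
move=> _ /=; have /IHh sz := h0.
have F0 : F != 0 by rewrite -msize_poly_eq0; lia.
have p0 : peval h F != 0 by rewrite -msize_poly_eq0 sz.
have := msizeM p0 F0; rewrite sz => E.
have [k Ek] : exists k, size h = k.+1.
  by exists (size h).-1; rewrite prednK ?size_poly_gt0.
rewrite addrC msizeDr E Ek /= ?mulSn; [lia | ].
by apply: leq_ltn_trans Hc _; lia.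
Qed.

Lemma affine_coefs a b c (p : P) : p = a *: x0 + b *: x1 + c%:MP ->
  [/\ p@_U_(ord0) = a, p@_U_(ord_max) = b & p@_0%MM = c].
Proof.
move=> ->; rewrite !mcoeffD !mcoeffZ !mcoeffX !mcoeffC !eq_mnm1 !mnm1_eq0 !eqxx.
by rewrite /= !(mulr0, mulr1, addr0, add0r).
Qed.

Lemma affine_eq_const a b c : a *: x0 + b *: x1 = c%:MP -> a = 0 /\ b = 0.
Proof.
move=> E; have E' : (c%:MP : P) = a *: x0 + b *: x1 + 0%:MP by rewrite E mpolyC0 addr0.
have [<- <- _] := affine_coefs E'.
by rewrite !mcoeffC !mnm1_eq0 mulr0.
Qed.

(** * The identification with R[x0][x1] and automorphisms fixing x0 *)

(** The outer variable is [x1], so that [size] reads off the degree in [x1] alone. *)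
Definition to_iterated : P -> {poly {poly R}} :=
  mmap (polyC \o polyC) (fun i : 'I_2 => if i == ord0 then 'X%:P else 'X).

Definition of_iterated (q : {poly {poly R}}) : P :=
  horner_eval x1 (map_poly (horner_eval x0 \o map_poly (@mpolyC 2 R)) q).

Lemma to_iteratedC c : to_iterated c%:MP = c%:P%:P.
Proof. by rewrite /to_iterated mmapC. Qed.
Lemma to_iterated_x0 : to_iterated x0 = 'X%:P.
Proof. by rewrite /to_iterated mmapX mmap1U. Qed.
Lemma to_iterated_x1 : to_iterated x1 = 'X.
Proof. by rewrite /to_iterated mmapX mmap1U. Qed.
Lemma to_iteratedD p q : to_iterated (p + q) = to_iterated p + to_iterated q.
Proof. exact: mmapD. Qed.
Lemma to_iteratedM p q : to_iterated (p * q) = to_iterated p * to_iterated q.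
Proof. by rewrite /to_iterated rmorphM. Qed.

Lemma of_iteratedX : of_iterated 'X = x1.
Proof. by rewrite /of_iterated map_polyX /horner_eval hornerX. Qed.
Lemma of_iteratedC h : of_iterated h%:P = peval h x0.
Proof. by rewrite /of_iterated map_polyC /horner_eval hornerC. Qed.
Lemma of_iteratedD : {morph of_iterated : p q / p + q}.
Proof. by move=> p q; rewrite /of_iterated !rmorphD. Qed.
Lemma of_iteratedM : {morph of_iterated : p q / p * q}.
Proof. by move=> p q; rewrite /of_iterated !rmorphM. Qed.

Lemma to_iteratedK : cancel to_iterated of_iterated.
Proof.
apply: mpoly_gen_ind => [c||p q IHp IHq|p q IHp IHq].
- by rewrite to_iteratedC of_iteratedC pevalC.
- apply: ord2P; last by rewrite to_iterated_x1 of_iteratedX.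
  by rewrite to_iterated_x0 of_iteratedC pevalX.
- by rewrite to_iteratedD of_iteratedD IHp IHq.
- by rewrite to_iteratedM of_iteratedM IHp IHq.
Qed.

(** An endomorphism fixing [x0] is linear over R[x0], hence is the substitution of [f x1] for the
    outer variable. *)
Lemma to_iterated_comp f p : is_Ralg_endo f -> f x0 = x0 ->
  to_iterated (f p) = to_iterated p \Po to_iterated (f x1).
Proof.
move=> Hf f0; move: p; apply: mpoly_gen_ind => [c||p q IHp IHq|p q IHp IHq].
- by rewrite endoC // to_iteratedC comp_polyC.
- apply: ord2P; last by rewrite to_iterated_x1 comp_polyX.
  by rewrite f0 to_iterated_x0 comp_polyC.
- by rewrite endoD // !to_iteratedD IHp IHq comp_polyD.
- by rewrite endoM // !to_iteratedM IHp IHq comp_polyM.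
Qed.

(* Viewed in R[x0][x1], f acts as composition with F = f x1, and composition
   multiplies the degrees in x1, so F has degree 1 in x1. *)
Lemma fix_x0_normal f : is_Raut f -> f x0 = x0 ->
  exists c h, c \is a GRing.unit /\ f x1 = c *: x1 + peval h x0.
Proof.
move=> [Hf [g fK gK]] f0.
set F := to_iterated (f x1); set G := to_iterated (g x1).
have E : G \Po F = 'X by rewrite -to_iterated_comp // gK to_iterated_x1.
have [szG szF] : size G = 2 /\ size F = 2.
  have := congr1 (fun q : {poly _} => (size q).-1) E.
  rewrite size_comp_poly size_polyX /= => /eqP; rewrite muln_eq1.
  by case/andP; case: (size G) => [|[|[]]] // _; case: (size F) => [|[|[]]].
have := congr1 lead_coef E; rewrite lead_coef_comp ?szF // szG expr1 lead_coefX.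
rewrite {2}/lead_coef szF => GF1.
(* Comparison of leading coefficients makes the [x1]-coefficient of [F] a unit of R[x0]; over a
   domain such a unit is a constant. *)
have : F`_1 \is a GRing.unit by apply/unitrPr; exists (lead_coef G); rewrite mulrC.
rewrite poly_unitE => /andP[sz1 uc]; exists F`_1`_0, F`_0; split=> //.
have EF : F = F`_1 *: 'X + (F`_0)%:P.
  apply/polyP => -[|[|i]]; rewrite coefD coefZ coefX coefC /= ?mulr0 ?mulr1 ?add0r ?addr0 //.
  by rewrite nth_default ?szF.
rewrite -[LHS]to_iteratedK -/F {1}EF -mul_polyC.
rewrite of_iteratedD of_iteratedM !of_iteratedC of_iteratedX.
by congr (_ + _); rewrite [in LHS](size1_polyC (eq_leq (eqP sz1))) pevalC mul_mpolyC.
Qed.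

(** * The affine and triangular subgroups *)

(** Degree at most one is easier to propagate than degree exactly one; the two agree for
    automorphisms, by [affine_affine_aut]. *)
Definition affine f := is_Raut f /\ forall i : 'I_2, (msize (f 'X_i) <= 2)%N.

(** Only the image of [x0] is prescribed: bijectivity then forces the shape of [f x1], as
    [triangular_normal] shows. *)
Definition triangular f := is_Raut f /\ exists a b, f x0 = a *: x0 + b%:MP.

Lemma affine_id : affine id.
Proof. by split=> [|i]; [exact: raut_id | rewrite msizeX mdeg1]. Qed.

Lemma affine_le2 f p : affine f -> (msize p <= 2)%N -> (msize (f p) <= 2)%N.
Proof.
move=> [[Hf _] Af] /affE[a [b [c ->]]].
by rewrite !(endoD Hf) !(endoZ Hf) (endoC Hf) msize_affine_le.
Qed.

Lemma affine_comp f g : affine f -> affine g -> affine (f \o g).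
Proof.
move=> Af Ag; split=> [|i]; first by apply: raut_comp; [case: Af | case: Ag].
by apply: (affine_le2 Af); case: Ag.
Qed.

(** Cramer's rule: [f] sends the adjugate forms to [d *: x0] and [d *: x1], with [d] the
    determinant. It is enough that [d] be nonzero, since scaling by it preserves degrees. *)
Lemma affine_can f g : affine f -> cancel f g -> cancel g f -> affine g.
Proof.
move=> [rf Af] fK gK; have [Hg _] := raut_can rf fK gK; split; first exact: raut_can fK gK.
have [Hf _] := rf.
have /affE[a [b [c E0]]] := Af ord0; have /affE[a' [b' [c' E1]]] := Af ord_max.
pose d := a * b' - b * a'.
have D0 : f (b' *: x0 - b *: x1 - (b' * c - b * c')%:MP) = d *: x0.
  rewrite !(endoB Hf) !(endoZ Hf) (endoC Hf) E0 E1 -!mul_mpolyC /d !(mpolyCB, mpolyCM); ring.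
have D1 : f (a *: x1 - a' *: x0 - (a * c' - a' * c)%:MP) = d *: x1.
  rewrite !(endoB Hf) !(endoZ Hf) (endoC Hf) E0 E1 -!mul_mpolyC /d !(mpolyCB, mpolyCM); ring.
(* If [d = 0], injectivity kills both adjugate forms, so the linear part of [f] vanishes and [f x0]
   is constant, which is absurd. *)
have d0 : d != 0.
  apply/eqP => d0; rewrite d0 !scale0r -(endo0 Hf) in D0 D1.
  have fI := can_inj fK.
  have /affine_eq_const[_ b0] : b' *: x0 + (- b) *: x1 = (b' * c - b * c')%:MP.
    by apply/subr0_eq; rewrite scaleNr; apply: fI.
  have /affine_eq_const[a0 a0'] : (- a') *: x0 + a *: x1 = (a * c' - a' * c)%:MP.
    by apply/subr0_eq; rewrite scaleNr [X in X - _]addrC; apply: fI.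
  have b'0 : b = 0 by apply: oppr_inj; rewrite oppr0.
  have := raut_const rf (_ : f x0 = c%:MP); rewrite E0 a0' b'0 !scale0r !add0r => /(_ erefl).
  move/(congr1 (mcoeff U_(ord0))); rewrite mcoeffX mcoeffC eqxx mnm1_eq0 mulr0.
  by move/eqP; rewrite oner_eq0.
have szg L i : f L = d *: 'X_i -> (msize L <= 2)%N -> (msize (g 'X_i) <= 2)%N.
  by move=> /(congr1 g); rewrite fK (endoZ Hg) => ->; rewrite msizeZ.
apply: ord2P.
  apply: szg D0 _; rewrite -mpolyCN -scaleNr.
  by apply: msize_affine_le; rewrite ?msizeX ?mdeg1.
apply: szg D1 _; rewrite -mpolyCN -scaleNr.
by apply: msize_affine_le; rewrite ?msizeX ?mdeg1.
Qed.

Lemma triangular_comp f g : triangular f -> triangular g -> triangular (f \o g).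
Proof.
move=> [rf [a [b f0]]] [rg [c [d g0]]]; split; first exact: raut_comp.
have [Hf _] := rf; exists (c * a), (c * b + d).
rewrite /= g0 (endoD Hf) (endoZ Hf) (endoC Hf) f0 -!mul_mpolyC mpolyCD !mpolyCM; ring.
Qed.

(** Applying the inverse [g] and reading the coefficient of [x0] exhibits an inverse of [a]. *)
Lemma triangular_unit f a b : is_Raut f -> f x0 = a *: x0 + b%:MP -> a \is a GRing.unit.
Proof.
move=> rf f0; have [_ [g fK gK]] := rf.
have [Hg _] := raut_can rf fK gK.
have := congr1 (mcoeff U_(ord0)) (congr1 g f0).
rewrite fK (endoD Hg) (endoZ Hg) (endoC Hg) mcoeffD mcoeffZ mcoeffX mcoeffC eqxx mnm1_eq0.
by rewrite mulr0 addr0 => E; apply/unitrPr; exists (g x0)@_U_(ord0).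
Qed.

Lemma triangular_can f g : triangular f -> cancel f g -> cancel g f -> triangular g.
Proof.
move=> [rf [a [b f0]]] fK gK; have rg := raut_can rf fK gK; split=> //.
have ua := triangular_unit rf f0; have [Hg _] := rg.
exists a^-1, (- (a^-1 * b)).
have := congr1 g f0; rewrite fK (endoD Hg) (endoZ Hg) (endoC Hg) => E; rewrite [in RHS]E.
by rewrite scalerDr scalerA mulVr // scale1r mpolyCN mpolyCM mul_mpolyC addrK.
Qed.

(** Composing with the inverse [e'] of the substitution [x0 -> a x0 + b] reduces to an automorphism
    fixing [x0]; undoing it replaces [h] by its composite with [a X + b]. *)
Lemma triangular_normal f : triangular f -> exists a b c h,
  [/\ a \is a GRing.unit, c \is a GRing.unit,
      f x0 = a *: x0 + b%:MP & f x1 = c *: x1 + peval h x0].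
Proof.
move=> [rf [a [b f0]]]; have ua := triangular_unit rf f0.
pose e := subst2 (a *: x0 + b%:MP) x1; pose e' := subst2 (a^-1 *: (x0 - b%:MP)) x1.
have He : is_Ralg_endo e by apply: subst2_endo.
have He' : is_Ralg_endo e' by apply: subst2_endo.
have e0 : e x0 = a *: x0 + b%:MP by apply: subst2_x0.
have e1 : e x1 = x1 by apply: subst2_x1.
have e'0 : e' x0 = a^-1 *: (x0 - b%:MP) by apply: subst2_x0.
have e'1 : e' x1 = x1 by apply: subst2_x1.
have eK : cancel e e'.
  apply: endo2_can => //; last by rewrite e1 e'1.
  by rewrite e0 (endoD He') (endoZ He') (endoC He') e'0 scalerA mulrV // scale1r subrK.
have e'K : cancel e' e.
  apply: endo2_can => //; last by rewrite e'1 e1.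
  by rewrite e'0 (endoZ He) (endoB He) (endoC He) e0 addrK scalerA mulVr // scale1r.
have re' : is_Raut e' by split=> //; exists e.
have [|c [h [uc f1]]] := fix_x0_normal (raut_comp re' rf).
  by rewrite /= f0 -e0 eK.
exists a, b, c, (h \Po (a *: 'X + b%:P)); split=> //.
rewrite -[LHS]e'K -[e' (f x1)]/((e' \o f) x1) f1.
rewrite (endoD He) (endoZ He) (endo_peval _ _ He) e0 e1.
by rewrite peval_comp pevalD pevalZ pevalX pevalC.
Qed.

Lemma unit_neq0 (a : R) : a \is a GRing.unit -> a != 0.
Proof. by apply: contraTneq => ->; rewrite unitr0. Qed.

(** * Degree growth along alternating compositions *)

(** An element of the intersection merges with a syllable of either type, so two syllables that do
    not merge are strictly of opposite types. *)
Definition nomerge f g :=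
  ~ (affine f /\ affine g) /\ ~ (triangular f /\ triangular g).

(* [ready s f]: [s] is strictly of one type and the degrees of [f x0], [f x1] are
   such that composing [f] with [s] on the right increases [growth]. *)
Definition ready s f :=
  (1 < msize (f x0))%N /\
  (triangular s /\ ~ affine s /\ (msize (f x1) <= msize (f x0))%N \/
   affine s /\ ~ triangular s /\ (msize (f x0) < msize (f x1))%N).

(** A triangular step keeps the degree of [f x0] but turns the last bit on; an affine step turns the
    bit off but raises that degree. Doubling makes both an increase. *)
Definition growth f : nat :=
  ((msize (f x0)).*2 + (msize (f x0) < msize (f x1)))%N.

Lemma affine_ready_id s : affine s -> ~ triangular s ->
  msize (s x0) = 2 /\ (msize (s x1) <= 2)%N.
Proof.
move=> [rs As] nT; split=> //; have /affE[a [b [c s0]]] := As ord0.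
have [b0|b0] := eqVneq b 0.
  by case: nT; split=> //; exists a, c; rewrite s0 b0 scale0r addr0.
have := As ord0; suff : (1 < msize (s x0))%N by lia.
rewrite ltnNge; apply/negP => /msize1_polyC; rewrite s0.
have [+ + _] := affine_coefs s0.
move=> _ Eb /(congr1 (mcoeff U_(ord_max))); rewrite -s0 Eb mcoeffC mnm1_eq0 mulr0.
exact/eqP.
Qed.

(** Starts the growth argument at [f = s]: a triangular [s] that is not affine must have [s x1] of
    degree at least 2. *)
Lemma first_ready s t : affine s \/ triangular s -> affine t \/ triangular t ->
  nomerge s t -> ready t s.
Proof.
move=> Hs Ht [nA nT]; case: Hs => Hs.
  have [ntA tT] : ~ affine t /\ triangular t by tauto.
  have [|s0 s1] := affine_ready_id Hs; first by tauto.
  by split; [rewrite s0 | left; rewrite s0].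
have [tA ntT] : affine t /\ ~ triangular t by tauto.
have [a [b [c [h [ua uc s0 s1]]]]] := triangular_normal Hs.
have sz0 : msize (s x0) = 2.
  rewrite s0 addrC msizeDr msizeZ ?unit_neq0 ?msizeX ?mdeg1 //.
  exact: leq_ltn_trans (msize_const _) _.
split; [by rewrite sz0 | right; split=> //; split=> //].
rewrite sz0 ltnNge; apply/negP => le2; apply: nA; split=> //.
by case: Hs => rs _; split=> //; apply: ord2P; rewrite ?sz0.
Qed.

(** Right composition evaluates [f] on [s x0] and [s x1]. A triangular [s] makes [h (f x0)] dominate
    in the second slot; an affine one moves the dominant [f x1] into the first. *)
Lemma ready_step f s t : is_Ralg_endo f -> ready s f ->
  affine t \/ triangular t -> nomerge s t ->
  ready t (f \o s) /\ (growth f < growth (f \o s))%N.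
Proof.
move=> Hf [f0 [[Ts [nAs le10]]|[As [nTs lt01]]]] Ht [nA nT].
  have [tA ntT] : affine t /\ ~ triangular t by tauto.
  have [a [b [c [h [ua uc s0 s1]]]]] := triangular_normal Ts.
  (* That is, [h] has degree at least 2, since otherwise [s] would be affine. *)
  have szh : (2 < size h)%N.
    rewrite ltnNge; apply/negP => sz2; apply: nAs; split; first by case: Ts.
    have sx i : (msize ('X_i : P) <= 2)%N by rewrite msizeX mdeg1.
    have sc d : (msize (d%:MP : P) <= 2)%N by apply: leq_trans (msize_const _) _.
    apply: ord2P; rewrite ?s0 ?s1; apply: msizeD_max => //; try exact: msizeZ_max.
    have [->|h0] := eqVneq h 0; first by rewrite peval0 mmeasure0.
    by rewrite size_peval ?msizeX ?mdeg1 //; move: sz2; case: (size h) => [|[|[]]].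
  have e0 : msize (f (s x0)) = msize (f x0).
    rewrite s0 (endoD Hf) (endoZ Hf) (endoC Hf) addrC msizeDr msizeZ ?unit_neq0 //.
    exact: leq_ltn_trans (msize_const _) _.
  have lt1 : (msize (f x0) < msize (f (s x1)))%N.
    have szp : (msize (f x0) < msize (peval h (f x0)))%N.
      rewrite size_peval // -?size_poly_gt0; last by lia.
      move: szh f0; case: (size h) => [|[|[|k]]] //=; case: (msize _) => [|[|j]] //= _ _.
      by rewrite !mulSn; lia.
    rewrite s1 (endoD Hf) (endoZ Hf) (endo_peval _ _ Hf) msizeDr //.
    by apply: leq_ltn_trans (msizeZ_le _ _) _; apply: leq_ltn_trans szp.
  split; first by split; [rewrite /= e0 | right; rewrite /= e0].
  by rewrite /growth /= e0 lt1 (leq_gtF le10); lia.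
have [ntA tT] : ~ affine t /\ triangular t by tauto.
have [rs Es] := As.
have /affE[a [b [c s0]]] := Es ord0; have /affE[a' [b' [c' s1]]] := Es ord_max.
(* So [f x1] really occurs in [f (s x0)] and determines its degree. *)
have b0 : b != 0.
  by apply/eqP => b0; apply: nTs; split=> //; exists a, c; rewrite s0 b0 scale0r addr0.
have e0 : msize (f (s x0)) = msize (f x1).
  by rewrite s0 !(endoD Hf) !(endoZ Hf) (endoC Hf) msize_aff //; apply: ltn_trans lt01.
have le1 : (msize (f (s x1)) <= msize (f x1))%N.
  rewrite s1 !(endoD Hf) !(endoZ Hf) (endoC Hf) msize_affine_le //; first exact: ltnW.
  exact: leq_ltn_trans lt01.
split; first by split; [rewrite /= e0; lia | left; rewrite /= e0].
by rewrite /growth /= e0 lt01; lia.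
Qed.

(** * Words in affine and triangular syllables *)

Definition weval (w : seq (P -> P)) : P -> P := foldr (fun s g => s \o g) id w.

(** Tameness is recorded because a syllable may later serve as a conjugator. *)
Fixpoint word (w : seq (P -> P)) : Prop :=
  if w is s :: w' then (tame s /\ (affine s \/ triangular s)) /\ word w' else True.

(** With the first syllable as a parameter, cyclic reducedness of [s :: w] reads
    [chain s (rcons w s)]. *)
Fixpoint chain s (w : seq (P -> P)) : Prop :=
  if w is t :: w' then nomerge s t /\ chain t w' else True.

Lemma weval_cat u v : weval (u ++ v) = weval u \o weval v.
Proof. by elim: u => //= s u ->. Qed.

Lemma word_cat u v : word (u ++ v) <-> word u /\ word v.
Proof. by elim: u => /= [|s u IHu]; tauto. Qed.

Lemma chain_rcons s w t : chain s (rcons w t) <-> chain s w /\ nomerge (last s w) t.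
Proof. by elim: w s => /= [|r w IHw] s; [tauto | rewrite IHw; tauto]. Qed.

Lemma chainPn s w : ~ chain s w ->
  exists u r t v, s :: w = u ++ r :: t :: v /\ ~ nomerge r t.
Proof.
elim: w s => //= t w IHw s nC; have [st|nst] := classic (nomerge s t).
  have [|u [r [r' [v [-> nrt]]]]] := IHw t; first by tauto.
  by exists (s :: u), r, r', v.
by exists [::], s, t, w.
Qed.

Lemma syllable_comp s t : ~ nomerge s t -> tame s -> tame t ->
  tame (s \o t) /\ (affine (s \o t) \/ triangular (s \o t)).
Proof.
move=> nm ts tt; split; first exact: tame_comp.
have [[? ?]|?] := classic (affine s /\ affine t); first by left; apply: affine_comp.
have [[? ?]|?] := classic (triangular s /\ triangular t).
  by right; apply: triangular_comp.
by case: nm.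
Qed.

Lemma word_endo w : word w -> is_Ralg_endo (weval w).
Proof. by elim: w => //= s w IHw [[/tame_raut[Hs _] _] /IHw Hw]; apply: endo_comp. Qed.

(** Iterates [ready_step]; [t] is the syllable that will follow the word, so the conclusion can be
    fed back for the next round. *)
Lemma chain_growth w f s t : is_Ralg_endo f -> ready s f ->
  word (s :: w) -> chain s (rcons w t) -> affine t \/ triangular t ->
  ready t (f \o weval (s :: w)) /\ (growth f < growth (f \o weval (s :: w)))%N.
Proof.
elim: w f s => [|r w IHw] f s Hf rd.
  by move=> _ [nm _] Ht; apply: ready_step.
move=> [[ts Hs] Hw] [nm Hc] Ht.
have [rd' lt1] := ready_step Hf rd (proj2 (proj1 Hw)) nm.
have [Hs' _] := tame_raut ts.
have [rd'' lt2] := IHw _ _ (endo_comp Hf Hs') rd' Hw Hc Ht.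
by split; [exact: rd'' | exact: ltn_trans lt1 lt2].
Qed.

Lemma can_eq_fun f g g' : cancel g f -> cancel f g' -> g = g'.
Proof. by move=> gK fK; apply: functional_extensionality => p; rewrite -[in RHS](gK p) fK. Qed.

Lemma word_inv w g : word w -> cancel (weval w) g -> cancel g (weval w) ->
  exists w', word w' /\ g = weval w'.
Proof.
elim: w g => [|s w IHw] g.
  by move=> _ fK gK; exists [::]; split=> //; apply: can_eq_fun gK _.
move=> [[ts Hs] Hw] fK gK.
have [_ [si sK siK]] := tame_raut ts.
have [||w' [Hw' E]] := IHw (g \o s) Hw.
- by move=> p; apply: fK.
- by move=> p; apply: (can_inj sK); apply: gK.
exists (w' ++ [:: si]); split.
  apply/word_cat; split=> //=; split=> //; split; first exact: tame_inv ts sK siK.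
  by case: Hs => Hs; [left; apply: affine_can sK siK | right; apply: triangular_can sK siK].
by rewrite weval_cat -E; apply: functional_extensionality => p /=; rewrite siK.
Qed.

(** * Tame automorphisms as words *)

Definition swap : P -> P := subst2 x1 x0.

Lemma swap_endo : is_Ralg_endo swap. Proof. exact: subst2_endo. Qed.
Lemma swap0 : swap x0 = x1. Proof. exact: subst2_x0. Qed.
Lemma swap1 : swap x1 = x0. Proof. exact: subst2_x1. Qed.

Lemma swapK : involutive swap.
Proof.
by apply: endo2_can; rewrite ?(swap0, swap1) //; apply: swap_endo.
Qed.

Lemma swap_raut : is_Raut swap.
Proof. by split; [exact: swap_endo | exists swap; apply: swapK]. Qed.

Lemma affine_affine_aut f : affine f -> affine_aut f.
Proof.
move=> [rf Af]; split=> // i; apply/eqP; rewrite eqn_leq Af ltnNge.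
apply/negP => /msize1_polyC/(raut_const rf) /(congr1 (fun p : P => msize p)).
by rewrite msizeX mdeg1 mmeasureC; case: (_ == 0).
Qed.

Lemma swap_affine : affine swap.
Proof.
split; first exact: swap_raut.
by apply: ord2P; rewrite ?swap0 ?swap1 msizeX mdeg1.
Qed.

Lemma tame_word f : tame f -> exists w, word w /\ f = weval w.
Proof.
elim=> {f} [|f Af|f Ef|f g _ [u [Hu ->]] _ [v [Hv ->]]|f g _ [w [Hw ->]]|f g _ [w [Hw ->]] fg].
- by exists [::].
- exists [:: f]; split=> //=; split=> //; split; first exact: tame_affine.
  by left; case: Af => rf Af; split=> // i; rewrite Af.
- have tf := tame_elem Ef; have [rf [i Hi]] := Ef; elim/ord2P: i Hi => Hi; last first.
    exists [:: f]; split=> //=; split=> //; split=> //; right; split=> //.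
    by exists 1, 0; rewrite scale1r mpolyC0 addr0 Hi.
  (* Here [f] fixes [x1], so its conjugate by [swap] fixes [x0] and is triangular. *)
  have ts : tame swap by apply/tame_affine/affine_affine_aut/swap_affine.
  exists [:: swap; swap \o f \o swap; swap]; split.
    have As := swap_affine.
    split; [by split=> //; left|split; [|by split=> //; split=> //; left]].
    split; first by apply: tame_comp => //; apply: tame_comp.
    right; split; first by apply: raut_comp swap_raut; apply: raut_comp swap_raut _.
    by exists 1, 0; rewrite scale1r mpolyC0 addr0 /= swap0 Hi // swap1.
  by apply: functional_extensionality => p /=; rewrite !swapK.
- by exists (u ++ v); rewrite weval_cat; split=> //; apply/word_cat.
- by move=> fK gK; apply: word_inv Hw fK gK.
- by exists w; split=> //; apply: functional_extensionality.
Qed.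

(** * Locally nilpotent derivations and their exponentials *)

Lemma peval_x0_mcoeff h (m : 'X_{1..2}) : m ord_max != 0%N -> (peval h x0)@_m = 0.
Proof.
move=> m1; rewrite /peval horner_coef raddf_sum big1 //= => i _.
rewrite coef_map /= mul_mpolyC mcoeffZ mcoeffXn; case: eqP => [E|]; last by rewrite mulr0.
by move: m1; rewrite -E mulmnE mnm1E.
Qed.

Section Locnil.
Variable D : P -> P.
Hypothesis HD : is_LND D.

Lemma derD p q : D (p + q) = D p + D q. Proof. by case: HD => -[]. Qed.
Lemma derZ c p : D (c *: p) = c *: D p. Proof. by case: HD => -[]. Qed.
Lemma derM p q : D (p * q) = p * D q + q * D p. Proof. by case: HD => -[]. Qed.
Lemma der0 : D 0 = 0. Proof. by rewrite -(scale0r 0) derZ !scale0r. Qed.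

Lemma derC c : D c%:MP = 0.
Proof.
rewrite -[c%:MP]mulr1 mul_mpolyC derZ.
have /eqP := derM 1 1; rewrite !mul1r -subr_eq0 opprD addrA subrr sub0r oppr_eq0.
by move=> /eqP ->; rewrite scaler0.
Qed.

Lemma iter_der0 l : iter l D 0 = 0.
Proof. by elim: l => //= l ->; apply: der0. Qed.

Lemma iter_derD l p q : iter l D (p + q) = iter l D p + iter l D q.
Proof. by elim: l => //= l ->; apply: derD. Qed.

Lemma iter_derZ l c p : iter l D (c *: p) = c *: iter l D p.
Proof. by elim: l => //= l ->; apply: derZ. Qed.

Lemma iter_der_sum l k (c : nat -> R) (F : nat -> P) :
  iter l D (\sum_(i < k) c i *: F i) = \sum_(i < k) c i *: iter l D (F i).
Proof.
elim: k => [|k IHk]; first by rewrite !big_ord0 iter_der0.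
by rewrite !big_ord_recr /= iter_derD iter_derZ IHk.
Qed.

Lemma iter_der_eq0 l k p : iter l D p = 0 -> (l <= k)%N -> iter k D p = 0.
Proof. by move=> p0 /subnK <-; rewrite iterD p0 iter_der0. Qed.

(** Terms beyond a vanishing iterate are zero, so any such [l] may replace the index chosen by
    [epsilon]. *)
Lemma expD_sum l p : iter l D p = 0 ->
  expD D p = \sum_(k < l) ((k`!)%:R)^-1 *: iter k D p.
Proof.
have widen i k : iter i D p = 0 -> (i <= k)%N ->
    \sum_(j < k) ((j`!)%:R)^-1 *: iter j D p = \sum_(j < i) ((j`!)%:R)^-1 *: iter j D p.
  move=> i0; elim: k => [|k IHk]; first by rewrite leqn0 => /eqP ->.
  rewrite leq_eqVlt => /orP[/eqP -> //|]; rewrite ltnS => ik.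
  by rewrite big_ord_recr /= (iter_der_eq0 i0 ik) scaler0 addr0 IHk.
have nil0 : iter (nil_index D p) D p = 0.
  exact: (epsilon_spec (inhabits 0%N) (fun l => iter l D p = 0)) (proj2 HD p).
by move=> l0; rewrite /expD; case/orP: (leq_total (nil_index D p) l) => /widen ->.
Qed.

Lemma expD_bounded q : exists M, forall m, (msize (iter m (expD D) q) <= M)%N.
Proof.
have [N qN] := proj2 HD q.
pose M := (\max_(l < N) msize (iter l D q))%N.
(* Bounding all the iterates at once makes the property stable: [iter l D] of [expD D p] is a
   combination of further iterates of [p]. *)
pose S p := forall l, (msize (iter l D p) <= M)%N.
suff H m : S (iter m (expD D) q) by exists M => m; apply: (H m 0%N).
elim: m => [|m IHm] l /=.
  case: (ltnP l N) => [lN|Nl]; last by rewrite (iter_der_eq0 qN Nl) mmeasure0.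
  by apply: (leq_bigmax (Ordinal lN)).
set p := iter m _ _ in IHm *.
rewrite /expD (iter_der_sum _ _ (fun k => ((k`!)%:R)^-1) (fun k => iter k D p)).
apply: (big_ind (fun p : P => (msize p <= M)%N)).
- by rewrite mmeasure0.
- by move=> u v; apply: msizeD_max.
- by move=> i _; rewrite -iterD; apply/msizeZ_max/IHm.
Qed.

(* With q = (exp D - 1) p = D p + D^2 p / 2 + ..., the D^j q lie in V by induction
   on the nilpotency index, and D^j p is recovered from D^(j-1) q by descending
   induction on j. *)
Lemma expD_stable (V : P -> Prop) : V 0 -> (forall p q, V p -> V q -> V (p + q)) ->
  (forall c p, V p -> V (c *: p)) -> (forall p, V p -> V (expD D p)) ->
  forall p, V p -> V (D p).
Proof.
move=> V0 VD VZ Vexp.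
suff H N p : iter N D p = 0 -> V p -> V (D p).
  by move=> p; have [N pN] := proj2 HD p; apply: H pN.
elim: N p => [|N IHN] p pN Vp; first by move: pN => /= ->; rewrite der0.
case: N => [|N] in IHN pN *; first by move: pN => /= ->.
pose q := expD D p - p.
have Vq : V q by apply: VD; [apply: Vexp | rewrite -scaleN1r; apply: VZ].
have Eq : q = \sum_(k < N.+1) ((k.+1`!)%:R)^-1 *: iter k.+1 D p.
  by rewrite /q (expD_sum pN) big_ord_recl /= fact0 invr1 scale1r addrC addKr.
have qN : iter N.+1 D q = 0.
  rewrite Eq (iter_der_sum _ _ (fun k => ((k.+1`!)%:R)^-1) (fun k => iter k.+1 D p)).
  apply: big1 => i _; rewrite -iterD (iter_der_eq0 pN) ?scaler0 //; lia.
have Vqj j : V (iter j D q).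
  elim: j => [|j IHj] //=; apply: IHN IHj.
  by rewrite -iterD addnC iterD qN iter_der0.
suff H i j : (N.+2 <= i + j.+1)%N -> V (iter j.+1 D p) by apply: (H N.+1 0%N); lia.
elim: i j => [|i IHi] j ij; first by rewrite (iter_der_eq0 pN ij).
have := Vqj j.
rewrite Eq (iter_der_sum _ _ (fun k => ((k.+1`!)%:R)^-1) (fun k => iter k.+1 D p)).
rewrite big_ord_recl /= (_ : (1`!)%:R = 1) // invr1 scale1r -iterS -iterSr.
set r := \sum_(k < N) _ => Vpr.
have Vr : V r.
  apply: (big_ind V) => // k _; apply: VZ.
  by rewrite -[D (D _)]/(iter k.+2 D p) -iterD addnS; apply: IHi; lia.
by rewrite -[iter _ _ _](addrK r); apply: VD => //; rewrite -scaleN1r; apply: VZ.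
Qed.

(** Nilpotency forces [a = c = 0]: the coefficient of [x0] in the l-th iterate at [x0] is [a ^+ l],
    and then that of [x1] at [x1] is [c ^+ l]. *)
Lemma triangular_der_of_normal a b c h :
  D x0 = a *: x0 + b%:MP -> D x1 = c *: x1 + peval h x0 -> triangular_der D.
Proof.
move=> D0 D1.
have a0 : a = 0.
  have [l l0] := proj2 HD x0.
  have [d E] : exists d, iter l D x0 = a ^+ l *: x0 + d%:MP.
    elim: l {l0} => [|l [d IHl]]; first by exists 0; rewrite expr0 scale1r mpolyC0 addr0.
    exists (a ^+ l * b); rewrite iterS IHl derD derZ derC D0 addr0 scalerDr scalerA -exprSr.
    by rewrite mpolyCM mul_mpolyC.
  move: l0; rewrite E => /(congr1 (mcoeff U_(ord0))).
  rewrite mcoeffD mcoeffZ mcoeffX mcoeffC eqxx mnm1_eq0 mulr0 addr0 mulr1 mcoeff0.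
  by move/eqP; rewrite expf_eq0 => /andP[_ /eqP].
rewrite a0 scale0r add0r in D0.
(* Once [D x0] is constant, [D] preserves R[x0]. *)
have Dpeval k : exists k', D (peval k x0) = peval k' x0.
  elim/poly_ind: k => [|k d [k' IHk]]; first by exists 0; rewrite peval0 der0.
  exists (k * b%:P + 'X * k').
  by rewrite !(pevalD, pevalM, pevalX, pevalC) derD derC addr0 derM D0 IHk.
have c0 : c = 0.
  have [l l0] := proj2 HD x1.
  have [k E] : exists k, iter l D x1 = c ^+ l *: x1 + peval k x0.
    elim: l {l0} => [|l [k IHl]]; first by exists 0; rewrite expr0 scale1r peval0 addr0.
    have [k' Ek] := Dpeval k.
    exists (c ^+ l *: h + k'); rewrite iterS IHl derD derZ D1 Ek scalerDr scalerA -exprSr.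
    by rewrite pevalD pevalZ addrA.
  move: l0; rewrite E => /(congr1 (mcoeff U_(ord_max))).
  rewrite mcoeffD mcoeffZ mcoeffX eqxx peval_x0_mcoeff ?mnm1E ?eqxx // addr0 mulr1 mcoeff0.
  by move/eqP; rewrite expf_eq0 => /andP[_ /eqP].
rewrite c0 scale0r add0r in D1.
apply: ord2P => m; rewrite ?D0 ?D1 mcoeff_msupp.
  by rewrite mcoeffC; have [-> _ j _|] := eqVneq m 0%MM; rewrite ?mnm0E ?mulr0 ?eqxx.
by move=> m0; apply: ord2P => // _; apply/eqP; apply: contraNT m0 => /peval_x0_mcoeff ->.
Qed.

(** [expD_stable] is applied to the polynomials of degree at most 1 in the affine case, and to R x0
    + R and R x1 + R[x0] in the triangular case. *)
Lemma syllable_der : affine (expD D) \/ triangular (expD D) ->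
  triangular_der D \/ affine_der D.
Proof.
case=> [Ae|Te].
  right=> i; apply: (@expD_stable (fun p => (msize p <= 2)%N)).
  - by rewrite mmeasure0.
  - by move=> p q; apply: msizeD_max.
  - by move=> c p; apply: msizeZ_max.
  - by move=> p; apply: affine_le2.
  - by rewrite msizeX mdeg1.
left; have [[He _] _] := Te; have [a [b [c [h [_ _ e0 e1]]]]] := triangular_normal Te.
have [a' [b' D0]] : exists a b, D x0 = a *: x0 + b%:MP.
  apply: (@expD_stable (fun p => exists a b, p = a *: x0 + b%:MP)).
  - by exists 0, 0; rewrite scale0r mpolyC0 addr0.
  - move=> _ _ [u [v ->]] [u' [v' ->]]; exists (u + u'), (v + v').
    by rewrite mpolyCD scalerDl addrACA.
  - by move=> d _ [u [v ->]]; exists (d * u), (d * v);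
      rewrite scalerDr scalerA mpolyCM mul_mpolyC.
  - move=> _ [u [v ->]]; exists (u * a), (u * b + v).
    rewrite (endoD He) (endoZ He) (endoC He) e0 scalerDr scalerA.
    by rewrite mpolyCD mpolyCM mul_mpolyC addrA.
  - by exists 1, 0; rewrite scale1r mpolyC0 addr0.
have [c' [h' D1]] : exists c h, D x1 = c *: x1 + peval h x0.
  apply: (@expD_stable (fun p => exists c h, p = c *: x1 + peval h x0)).
  - by exists 0, 0; rewrite scale0r peval0 addr0.
  - move=> _ _ [u [v ->]] [u' [v' ->]]; exists (u + u'), (v + v').
    by rewrite pevalD scalerDl addrACA.
  - by move=> d _ [u [v ->]]; exists (d * u), (d *: v); rewrite scalerDr scalerA pevalZ.
  - move=> _ [u [v ->]]; exists (u * c), (u *: h + (v \Po (a *: 'X + b%:P))).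
    rewrite (endoD He) (endoZ He) (endo_peval _ _ He) e0 e1 scalerDr scalerA.
    by rewrite pevalD pevalZ peval_comp pevalD pevalZ pevalX pevalC addrA.
  - by exists 1, 0; rewrite scale1r peval0 addr0.
exact: triangular_der_of_normal D0 D1.
Qed.

End Locnil.

(** * Conjugation of derivations and of their exponentials *)

Section Conjugation.
Variables (D tau taui : P -> P).
Hypothesis HD : is_LND D.
Hypotheses (Ht : is_Raut tau) (tauK : cancel tau taui) (tauiK : cancel taui tau).

Lemma iter_conj l p : iter l (taui \o D \o tau) p = taui (iter l D (tau p)).
Proof. by elim: l => [|l IHl] /=; rewrite ?tauK // IHl tauiK. Qed.

Lemma conj_LND : is_LND (taui \o D \o tau).
Proof.
have [Hi _] := raut_can Ht tauK tauiK; have [Hf _] := Ht.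
split; last first.
  by move=> p; have [l l0] := proj2 HD (tau p); exists l; rewrite iter_conj l0 (endo0 Hi).
split=> [p q|c p|p q] /=.
- by rewrite (endoD Hf) (derD HD) (endoD Hi).
- by rewrite (endoZ Hf) (derZ HD) (endoZ Hi).
- by rewrite (endoM Hf) (derM HD) (endoD Hi) !(endoM Hi) !tauK.
Qed.

(** One [l] truncates both series, at [tau p] for [D] and at [p] for its conjugate, so they agree
    term by term. *)
Lemma expD_conj : expD (taui \o D \o tau) = taui \o expD D \o tau.
Proof.
apply: functional_extensionality => p /=.
have [Hi _] := raut_can Ht tauK tauiK.
have [l l0] := proj2 HD (tau p).
rewrite (expD_sum HD l0) (@expD_sum _ conj_LND l) ?iter_conj ?l0 ?(endo0 Hi) //.
rewrite (big_morph taui (endoD Hi) (endo0 Hi)).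
by apply: eq_bigr => i _; rewrite iter_conj (endoZ Hi).
Qed.

End Conjugation.

(** * Shortening the word of the exponential *)

(** For a cyclically reduced word the powers of [expD D], followed on the right by [s], have
    [growth] at least the exponent, against [expD_bounded] at [s x0]. *)
Lemma chain_unbounded D s w : is_LND D -> expD D = weval (s :: w) ->
  word (s :: w) -> w <> [::] -> ~ chain s (rcons w s).
Proof.
move=> HD E; case: w E => // t w E Hw _ Hc.
have [[ts Hs] [[tt Ht] Hw']] := Hw; have [nst Hc'] := Hc.
have [Hse _] := tame_raut ts.
have He : is_Ralg_endo (expD D) by rewrite E; apply: word_endo.
have grow m : ready t (iter m (expD D) \o s) /\ (m <= growth (iter m (expD D) \o s))%N.
  elim: m => [|m [rd le]]; first by split=> //; apply: first_ready nst.
  have Hm : is_Ralg_endo (iter m (expD D)).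
    by elim: m {rd le} => [|m IHm] //; apply: endo_comp.
  (* Regroups (s t w)^(m+1) s as (s t w)^m s times t w s, so that each round starts at [t]. *)
  have Es : iter m.+1 (expD D) \o s = (iter m (expD D) \o s) \o weval (t :: rcons w s).
    apply: functional_extensionality => p.
    by rewrite [LHS]/= -iterS iterSr E /= -cats1 weval_cat.
  rewrite Es; have := @chain_growth (rcons w s) (iter m (expD D) \o s) t t.
  case=> //; first exact: endo_comp.
  - by split=> //; rewrite -cats1; apply/word_cat; split=> //=.
  - by apply/chain_rcons; rewrite last_rcons.
  - by move=> rd' lt; split=> //; apply: leq_ltn_trans lt.
(* Sizes at most [M] give [growth] at most 2M + 1, so the exponent 2M + 2 is contradictory. *)
have [M HM] := expD_bounded HD (s x0).
have [_ ] := grow (M.*2 + 2)%N; have := HM (M.*2 + 2)%N.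
by rewrite /growth /=; case: (_ < _)%N; lia.
Qed.

(** The induction on the length bound [n] ranges over all [D], because a cyclic merge replaces [D]
    by a conjugate. *)
Lemma syllable_conj n D w : is_LND D -> word w -> (size w <= n)%N -> expD D = weval w ->
  exists tau taui, [/\ tame tau, cancel tau taui, cancel taui tau &
    affine (expD (taui \o D \o tau)) \/ triangular (expD (taui \o D \o tau))].
Proof.
elim: n D w => [|n IHn] D w HD Hw sz E.
  case: w sz Hw E => // _ _ E; exists id, id; split=> //; first exact: tame_id.
  by left; rewrite -[id \o D \o id]/D E; apply: affine_id.
case: w => [|s [|t w]] in Hw sz E.
- exists id, id; split=> //; first exact: tame_id.
  by left; rewrite -[id \o D \o id]/D E; apply: affine_id.
- exists id, id; split=> //; first exact: tame_id.
  by rewrite -[id \o D \o id]/D E; case: Hw => -[].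
have nC := @chain_unbounded D s (t :: w) HD E Hw.
have [Hc|/chainPn[u [r [q [v [Ew nrq]]]]]] := classic (chain s (t :: w)); last first.
  move: Hw sz E; rewrite Ew => /word_cat[Hu [[tr _] [[tq _] Hv]]] sz E.
  apply: (IHn D (u ++ (r \o q) :: v)) => //.
  - by apply/word_cat; split=> //; split=> //; apply: syllable_comp.
  - by move: sz; rewrite !size_cat /=; lia.
  - by rewrite E !weval_cat.
move: Hw sz E nC Hc; rewrite (lastI t w).
move: (belast t w) (last t w) => v l Hw sz E nC Hc.
(* The word being reduced, cyclic reducedness can only fail between its last syllable [l] and its
   first syllable [s]. *)
have {nC} nls : ~ nomerge l s.
  move=> nls; apply: nC; first by case: (v).
  by apply/chain_rcons; rewrite last_rcons.
have [[ts Hs] ] := Hw; rewrite -cats1 => /word_cat[Hv [[tl _] _]].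
have rs := tame_raut ts; have [Hse [si sK siK]] := rs.
have Hexp := expD_conj HD rs sK siK.
have HD' := conj_LND HD rs sK siK.
(* Conjugating by [s] turns s v l into v (l s), whose last two letters merge into one syllable. *)
have [|||tau [taui [ttau tauK tauiK Htau]]] := IHn _ (rcons v (l \o s)) HD'.
- by rewrite -cats1; apply/word_cat; split=> //; split=> //; apply: syllable_comp.
- by move: sz; rewrite /= !size_rcons; lia.
- rewrite Hexp E -!cats1 /= !weval_cat /=.
  by apply: functional_extensionality => p /=; rewrite sK.
exists (s \o tau), (taui \o si); split=> //; first exact: tame_comp.
- by move=> p /=; rewrite sK tauK.
- by move=> p /=; rewrite tauiK siK.
Qed.

(** * Triangularizing affine derivations when V(R) = K^* *)

(** The iterates of [D] at [x0] stay of degree at most 1 and reach 0; the last nonconstant one,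
    stripped of its constant term, is the required form. *)
Lemma affine_der_kernel D : is_LND D -> affine_der D -> exists a b e : R,
  (a != 0) || (b != 0) /\ D (a *: x0 + b *: x1) = e%:MP.
Proof.
move=> HD HA.
have D2 p : (msize p <= 2)%N -> (msize (D p) <= 2)%N.
  move=> /affE[a [b [c ->]]]; rewrite !(derD HD) !(derZ HD) (derC HD) -mpolyC0.
  exact: msize_affine_le.
have H N p : iter N D p = 0 -> msize p = 2 -> exists q, msize q = 2 /\ (msize (D q) <= 1)%N.
  elim: N p => [|N IHN] p; first by move=> /= ->; rewrite mmeasure0.
  rewrite iterSr => pN p2; have [le1|gt1] := leqP (msize (D p)) 1; first by exists p.
  by apply: IHN pN _; apply/eqP; rewrite eqn_leq gt1 D2 ?p2.
have [N xN] := proj2 HD x0.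
have [|q [q2 /msize1_polyC Dq]] := H N x0 xN; first by rewrite msizeX mdeg1.
have [a [b [c E]]] := affE (eq_leq q2).
exists a, b, (D q)@_0%MM; split.
  rewrite -negb_and; apply/negP => /andP[/eqP a0 /eqP b0].
  have := msize_const c; suff <- : q = c%:MP by rewrite q2.
  by rewrite E a0 b0 !scale0r !add0r.
by rewrite -Dq E [in RHS](derD HD) (derC HD) addr0.
Qed.

(** The hypothesis is applied to the fraction a/b; when [a] or [b] is zero a coordinate vector
    serves. *)
Lemma unimodular_direction (a b : R) : V_is_Kunits R -> (a != 0) || (b != 0) ->
  exists al be u v : R, u * al + v * be = 1 /\ a * be = b * al.
Proof.
move=> HV; have [->|b0] := eqVneq b 0.
  by move=> _; exists 1, 0, 1, 0; rewrite !mulr0 mul0r mulr1 addr0.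
have [->|a0] := eqVneq a 0.
  by move=> _; exists 0, 1, 0, 1; rewrite !mulr0 mul0r mulr1 add0r.
move=> _; have ta0 : tofrac a != 0 by rewrite tofrac_eq0.
have tb0 : tofrac b != 0 by rewrite tofrac_eq0.
have [|al [be [al0 be0 [u [v uv]] E]]] := HV (tofrac a / tofrac b).
  by rewrite mulf_neq0 ?invr_eq0.
exists al, be, u, v; split=> //; apply/eqP; rewrite -tofrac_eq !tofracM mulrC.
have tbe0 : tofrac be != 0 by rewrite tofrac_eq0.
by move/eqP: E; rewrite eqr_div // => /eqP E; rewrite mulrC E mulrC.
Qed.

Lemma affine_der_triangularizable D : V_is_Kunits R -> is_LND D -> affine_der D ->
  exists tau taui, [/\ tame tau, cancel tau taui, cancel taui tau &
    triangular_der (taui \o D \o tau)].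
Proof.
move=> HV HD HA; have [a [b [e [ab De]]]] := affine_der_kernel HD HA.
have [al [be [u [v [uv E]]]]] := unimodular_direction HV ab.
(* The two forms are proportional, so a nonzero multiple of this value is constant, hence so is the
   value. *)
have [e' De'] : exists e', D (al *: x0 + be *: x1) = e'%:MP.
  exists (D (al *: x0 + be *: x1))@_0%MM; apply: msize1_polyC.
  have Ha : a *: (al *: x0 + be *: x1) = al *: (a *: x0 + b *: x1).
    by rewrite !scalerDr !scalerA E (mulrC a) (mulrC b).
  have Hb : b *: (al *: x0 + be *: x1) = be *: (a *: x0 + b *: x1).
    by rewrite !scalerDr !scalerA -E (mulrC a) (mulrC b).
  case/orP: ab => nz; rewrite -(msizeZ _ nz) -(derZ HD).
    by rewrite Ha (derZ HD) De; apply/msizeZ_max/msize_const.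
  by rewrite Hb (derZ HD) De; apply/msizeZ_max/msize_const.
(* The unimodular row is completed to a matrix of determinant [u * al + v * be = 1]; [taui] comes
   from the inverse matrix. *)
pose tau := subst2 (al *: x0 + be *: x1) ((- v) *: x0 + u *: x1).
pose taui := subst2 (u *: x0 + (- be) *: x1) (v *: x0 + al *: x1).
have Ht : is_Ralg_endo tau by apply: subst2_endo.
have Hi : is_Ralg_endo taui by apply: subst2_endo.
have t0 : tau x0 = al *: x0 + be *: x1 by apply: subst2_x0.
have t1 : tau x1 = (- v) *: x0 + u *: x1 by apply: subst2_x1.
have i0 : taui x0 = u *: x0 + (- be) *: x1 by apply: subst2_x0.
have i1 : taui x1 = v *: x0 + al *: x1 by apply: subst2_x1.
have uvC : u%:MP_[2] * al%:MP + v%:MP * be%:MP = 1 by rewrite -!mpolyCM -mpolyCD uv mpolyC1.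
have tauK : cancel tau taui.
  apply: endo2_can => //; rewrite ?t0 ?t1 (endoD Hi) !(endoZ Hi) i0 i1 -!mul_mpolyC !mpolyCN.
    by rewrite -[RHS]mul1r -uvC; ring.
  by rewrite -[RHS]mul1r -uvC; ring.
have tauiK : cancel taui tau.
  apply: endo2_can => //; rewrite ?i0 ?i1 (endoD Ht) !(endoZ Ht) t0 t1 -!mul_mpolyC !mpolyCN.
    by rewrite -[RHS]mul1r -uvC; ring.
  by rewrite -[RHS]mul1r -uvC; ring.
have rt : is_Raut tau by split=> //; exists taui.
have ri : is_Raut taui by split=> //; exists tau.
have lin2 (c d : R) : (msize (c *: x0 + d *: x1) <= 2)%N.
  by apply: msizeD_max; apply: msizeZ_max; rewrite msizeX mdeg1.
have At : affine tau by split=> //; apply: ord2P; rewrite ?t0 ?t1.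
have Ai : affine taui by split=> //; apply: ord2P; rewrite ?i0 ?i1.
exists tau, taui; split=> //; first exact/tame_affine/affine_affine_aut.
have HD' := conj_LND HD rt tauK tauiK.
have : (msize ((taui \o D \o tau) x1) <= 2)%N.
  apply: (affine_le2 Ai); rewrite t1 (derD HD) !(derZ HD).
  by apply: msizeD_max; apply: msizeZ_max.
move=> /affE[c [d [k E1]]].
(* The conjugate sends [x0] to a constant and [x1] to an affine polynomial; nilpotency then removes
   the coefficient [d]. *)
apply: (@triangular_der_of_normal _ HD' 0 e' d (c *: 'X + k%:P)).
  by rewrite /= t0 De' (endoC Hi) scale0r add0r.
by rewrite E1 pevalD pevalZ pevalX pevalC addrA [d *: _ + _]addrC.
Qed.

End Plane.

Theorem theorem3p1p1 (R : idomainType) (D : {mpoly R[2]} -> {mpoly R[2]}) :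
  Q_domain R -> is_LND D -> tame (expD D) ->
  (exists tau taui : {mpoly R[2]} -> {mpoly R[2]},
      [/\ tame tau, cancel tau taui, cancel taui tau &
          triangular_der (taui \o D \o tau) \/ affine_der (taui \o D \o tau)])
  /\
  (V_is_Kunits R ->
   exists tau taui : {mpoly R[2]} -> {mpoly R[2]},
      [/\ tame tau, cancel tau taui, cancel taui tau &
          triangular_der (taui \o D \o tau)]).
Proof.
move=> _ HD /tame_word[w [Hw E]].
have [tau [taui [ttau tauK tauiK Hs]]] := syllable_conj HD Hw (leqnn _) E.
have HD' := conj_LND HD (tame_raut ttau) tauK tauiK.
have TA := syllable_der HD' Hs.
split; first by exists tau, taui.
(* In the affine case a second conjugation, by [sig], is composed with the first. *)
move=> HV; case: TA => [T|A]; first by exists tau, taui.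
have [sig [sigi [tsig sigK sigiK T]]] := affine_der_triangularizable HV HD' A.
exists (tau \o sig), (sigi \o taui); split=> //.
- exact: tame_comp.
- by move=> p /=; rewrite tauK sigK.
- by move=> p /=; rewrite sigiK tauiK.
Qed.
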